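(* Let $L$ be a 2-complex with one vertex and cyclically reduced attaching maps of 2-cells, and let $K=K_1\vee\cdots\vee K_n$ be a subcomplex of $L$ such that no edge of $K$ represents the trivial element in $\pi_1(K)$. Let $W(L,K)$ be the graph obtained from $\mathrm{lk}(L)$ by replacing each $\mathrm{lk}(K_i)$ by two vertices $k_i^+,k_i^-$ and exactly one edge $e_i$ connecting them, $1\le i\le n$. Suppose there is a real-valued weight function $\omega$ on the set of edges of $W(L,K)$ satisfying: 1. $\sum_{i}\omega(c_i)\le q-2$ whenever $c_1,\ldots,c_q$ are the corners of a 2-cell of $L-K$; 2. if $z$ is a homology reduced cycle in $W(L,K)$, then $\omega(z)\ge 2$; 3. $\omega(e_i)=0$ for $1\le i\le n$. Then $L$ is VA relative to $K$.
   Context: 2-complexes are 2-dimensional CW-complexes whose 2-cells are attached along closed edge paths. A 2-cell of $L-K$ means a 2-cell of $L$ not in $K$. Links. The link of a vertex $v$ of a 2-complex is the boundary of a regular neighborhood of $v$; it is a graph whose edges are the corners of 2-cells at $v$. For a 2-complex $L$ with a single vertex and oriented edge set $X$, the vertices of $\mathrm{lk}(L)$ are $\{x^+,x^-\mid x\in X\}$, where $x^+$ is a point of the oriented edge $x$ close to its beginning and $x^-$ a point close to its end. The graph $W(L,K)$. Its vertices are the vertices of $\mathrm{lk}(L)$ not in any $\mathrm{lk}(K_i)$, together with two additional vertices $k_i^+,k_i^-$ for each $i$. Its edges are the corners of 2-cells of $L$ not in any $K_i$, together with the edges $e_1,\ldots,e_n$, where $e_i$ joins $k_i^+$ and $k_i^-$.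 An end of a corner at a vertex $y^+$ (respectively $y^-$) of $\mathrm{lk}(K_i)$, where $y$ is an edge of $K_i$, is attached to $k_i^+$ (respectively $k_i^-$) in $W(L,K)$. Cycles and weights. A cycle is a closed edge path $z=a_1\cdots a_m$ in a graph, and $\omega(z)=\sum_{1\le i\le m}\omega(a_i)$. The cycle $z$ is homology reducible if it contains a pair of edges $a_i,a_j$ with $a_i=\bar a_j$ (the bar indicates opposite orientation), and homology reduced otherwise. Relative vertex asphericity. A map between complexes is combinatorial if it maps open cells homeomorphically onto open cells. A spherical diagram over $L$ is a combinatorial map $f\colon C\to L$, where $C$ is a 2-sphere with a cell structure. For a vertex $v$ of $C$, $f$ induces a combinatorial map from the circle $\mathrm{lk}(C,v)$ to $\mathrm{lk}(L)$, whose image is a cycle $z(v)=c_1\cdots c_q$. The vertex $v$ is a folding vertex if $z(v)$ is homology reducible, i.e. there are $i,j$ with $c_i=\bar c_j$; the pair $(d_i,d_j)$ of 2-cells of $C$ containing the preimages of $c_i$ and $c_j$ is then a folding pair, said to be in $L-K$ if its 2-cells are mapped to 2-cells of $L$ not in $K$. $L$ is VA (vertex aspherical) relative to $K$ if every spherical diagram $f\colon C\to L$ with $f(C)\not\subseteq K$ has a folding vertex with a folding pair of 2-cells in $L-K$. *)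

(* Defs.v *)
From mathcomp Require Import all_boot all_order all_algebra all_fingroup.
From mathcomp Require Import reals.

Set Implicit Arguments.
Unset Strict Implicit.
Unset Printing Implicit Defensive.

Import Order.TTheory GRing.Theory Num.Theory.
Local Open Scope ring_scope.

(** Graphs; loops and multiple edges are allowed. *)

Record graph := Graph {
  gvert : Type;
  gedge : Type;
  gsrc : gedge -> gvert;
  gtgt : gedge -> gvert }.

(* [(e, true)] is [e] traversed from [gsrc e] to [gtgt e], [(e, false)] is its
   reverse; the two are distinct even when [e] is a loop. *)
Definition oedge (G : graph) : Type := (gedge G * bool)%type.

Definition osrc (G : graph) (a : oedge G) : gvert G :=
  if a.2 then gsrc a.1 else gtgt a.1.

Definition otgt (G : graph) (a : oedge G) : gvert G :=
  if a.2 then gtgt a.1 else gsrc a.1.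

Definition obar (G : graph) (a : oedge G) : oedge G := (a.1, ~~ a.2).

Definition is_cycle (G : graph) (z : seq (oedge G)) : Prop :=
  (0 < size z)%N /\
  forall i : 'I_(size z),
    otgt (tnth (in_tuple z) i) = osrc (tnth (in_tuple z) (ordS i)).

Definition homology_reducible (G : graph) (z : seq (oedge G)) : Prop :=
  exists i j : 'I_(size z),
    tnth (in_tuple z) i = obar (tnth (in_tuple z) j).

Definition homology_reduced (G : graph) (z : seq (oedge G)) : Prop :=
  ~ homology_reducible z.

Definition weight (R : realType) (G : graph) (w : gedge G -> R)
    (z : seq (oedge G)) : R := \sum_(a <- z) w a.1.

(** 2-complexes with a single vertex. *)

(* The attaching path of a 2-cell is the word of the oriented edges it runs
   through: [(x, true)] is [x] and [(x, false)] is [x] traversed backwards.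
   Edges and 2-cells may be infinite in number. *)
Record complex2 := Complex2 {
  edge : Type;
  cell : Type;
  bdry : cell -> seq (edge * bool) }.

Definition letter (L : complex2) : Type := (edge L * bool)%type.

Definition linv (L : complex2) (a : letter L) : letter L := (a.1, ~~ a.2).

(* [Tagged _ i] with tag [r] stands both for the [i]-th side of [r] (the [i]-th
   letter of its attaching path) and for the corner of [r] at the beginning of
   that side. *)
Definition side (L : complex2) : Type := {r : cell L & 'I_(size (bdry r))}.

Definition mkside (L : complex2) (r : cell L) (i : 'I_(size (bdry r))) :
  side L := existT _ r i.

Definition side_letter (L : complex2) (c : side L) : letter L :=
  tnth (in_tuple (bdry (tag c))) (tagged c).

Definition side_next (L : complex2) (c : side L) : side L :=
  mkside (ordS (tagged c)).

Definition side_prev (L : complex2) (c : side L) : side L :=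
  mkside (ord_pred (tagged c)).

Definition cyclically_reduced (L : complex2) : Prop :=
  forall c : side L, side_letter c <> linv (side_letter (side_prev c)).

(* The vertex x^+ (resp. x^-) of the link is [(x, true)] (resp. [(x, false)]):
   an oriented edge stands for the point of the link near its beginning.  The
   end of the oriented edge [a] is then near [linv a]. *)
Definition lk (L : complex2) : graph :=
  {| gvert := letter L;
     gedge := side L;
     gsrc := fun c => side_letter c;
     gtgt := fun c => linv (side_letter (side_prev c)) |}.

(** Subcomplexes K = K_1 v ... v K_n. *)

(* [edgeK x = Some i] when the edge [x] lies in K_i, [None] when it is not in
   K; likewise for [cellK].  The K_i share only the vertex. *)
Record wedge_subcomplex (L : complex2) (n : nat) := WedgeSubcomplex {
  edgeK : edge L -> option 'I_n;
  cellK : cell L -> option 'I_n;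
  cellK_bdry : forall (c : side L) (i : 'I_n),
    cellK (tag c) = Some i -> edgeK (side_letter c).1 = Some i }.

(* Homotopy of edge loops of K, so that pi_1(K) is the set of words in the
   edges of K up to [homotopicK].  Letters outside K are never created or
   deleted: a word in the edges of K is only related to such words. *)
Inductive homotopicK (L : complex2) (n : nat) (K : wedge_subcomplex L n) :
    seq (letter L) -> seq (letter L) -> Prop :=
| homotopicK_refl u : homotopicK K u u
| homotopicK_sym u v : homotopicK K u v -> homotopicK K v u
| homotopicK_trans u v t :
    homotopicK K u v -> homotopicK K v t -> homotopicK K u t
| homotopicK_cancel u v a :
    edgeK K a.1 <> None -> homotopicK K (u ++ a :: linv a :: v) (u ++ v)
| homotopicK_cell u v r :
    cellK K r <> None -> homotopicK K (u ++ bdry r ++ v) (u ++ v).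

Definition edges_nontrivial (L : complex2) (n : nat)
    (K : wedge_subcomplex L n) : Prop :=
  forall x : edge L, edgeK K x <> None -> ~ homotopicK K [:: (x, true)] [::].

(** The graph W(L, K). *)

Definition cellLK (L : complex2) (n : nat) (K : wedge_subcomplex L n) : Type :=
  {r : cell L | cellK K r == None}.

Definition W_vert (L : complex2) (n : nat) (K : wedge_subcomplex L n) : Type :=
  ({a : letter L | edgeK K a.1 == None} + 'I_n * bool)%type.

Definition W_edge (L : complex2) (n : nat) (K : wedge_subcomplex L n) : Type :=
  ({r : cellLK K & 'I_(size (bdry (val r)))} + 'I_n)%type.

Definition W_k (L : complex2) (n : nat) (K : wedge_subcomplex L n)
    (i : 'I_n) (s : bool) : W_vert K := inr (i, s).

Definition W_e (L : complex2) (n : nat) (K : wedge_subcomplex L n)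
    (i : 'I_n) : W_edge K := inr i.

Definition W_corner (L : complex2) (n : nat) (K : wedge_subcomplex L n)
    (r : cellLK K) (i : 'I_(size (bdry (val r)))) : W_edge K :=
  inl (existT _ r i).

(* The map lk(L) -> W(L, K) on vertices, sending y^+ and y^- to k_i^+ and k_i^-
   when y is an edge of K_i. *)
Definition W_point (L : complex2) (n : nat) (K : wedge_subcomplex L n)
    (a : letter L) : W_vert K :=
  match edgeK K a.1 as o return edgeK K a.1 = o -> W_vert K with
  | Some i => fun _ => W_k K i a.2
  | None => fun h => inl (exist _ a (introT eqP h))
  end erefl.

Definition W (L : complex2) (n : nat) (K : wedge_subcomplex L n) : graph :=
  {| gvert := W_vert K;
     gedge := W_edge K;
     gsrc := fun e => match e with
       | inl c => W_point K (gsrc (mkside (tagged c) : gedge (lk L)))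
       | inr i => W_k K i true
       end;
     gtgt := fun e => match e with
       | inl c => W_point K (gtgt (mkside (tagged c) : gedge (lk L)))
       | inr i => W_k K i false
       end |}.

(** Cell structures on the oriented 2-sphere. *)

(* A dart is an oriented edge: [dopp] reverses it, [org] is its origin, [lft]
   the 2-cell on its left, and [turn] the next dart counterclockwise around its
   origin.  Hence [fnext d], the dart following [d] along the boundary of
   [lft d], is the one preceding [dopp d] around the end of [d].  A connected
   closed surface with Euler characteristic 2 is a sphere.  The only cell
   structure without darts has one vertex and one 2-cell. *)
Record sphere := Sphere {
  svert : finType;
  dart : finType;
  sface : finType;
  turn : {perm dart};
  dopp : dart -> dart;
  org : dart -> svert;
  lft : dart -> sface;
  fnext := (fun d => (turn^-1)%g (dopp d)) : dart -> dart;
  doppK : involutive dopp;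
  dopp_neq : forall d, dopp d != d;
  orgP : forall d e, (org d == org e) = fconnect turn d e;
  lftP : forall d e, (lft d == lft e) = fconnect fnext d e;
  lft_surj : dart -> forall c, exists d, lft d = c;
  svert_gt0 : (0 < #|svert|)%N;
  sphere_connected : forall u v,
    connect [rel a b | [exists d, (org d == a) && (org (dopp d) == b)]] u v;
  sphere_euler : (#|svert| + #|sface| = #|dart|./2 + 2)%N }.

(* Combinatorial maps C -> L.  [dlab d] is the image of the oriented edge [d]
   and [dcell c] that of the 2-cell [c], whose map preserves orientation iff
   [dsgn c].  The last datum [dside d] is the side of [dcell (lft d)] on which
   [d], as a side of [lft d], is mapped: the labels alone do not determine it
   when an attaching path is a proper power.  The number of sides is preserved
   since open 2-cells are mapped homeomorphically. *)
Record spherical_diagram (L : complex2) := SphericalDiagram {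
  dsphere :> sphere;
  dlab : dart dsphere -> letter L;
  dcell : sface dsphere -> cell L;
  dsgn : sface dsphere -> bool;
  dside : dart dsphere -> side L;
  dlab_opp : forall d, dlab (dopp d) = linv (dlab d);
  dside_cell : forall d, tag (dside d) = dcell (lft d);
  dside_fnext : forall d, dside (fnext d) =
    if dsgn (lft d) then side_next (dside d) else side_prev (dside d);
  dside_lab : forall d, dlab d =
    if dsgn (lft d) then side_letter (dside d)
    else linv (side_letter (dside d));
  dcell_size : forall c, #|[set d | lft d == c]| = size (bdry (dcell c)) }.

(* Around the vertex [org d], the corner of [lft d] between [d] and [turn d] is
   mapped to this oriented edge of lk(L), going from [dlab d] to
   [dlab (turn d)]; the cycle z(v) consists of the [corner_image d] for the
   darts [d] with [org d = v], in the order given by [turn]. *)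
Definition corner_image (L : complex2) (C : spherical_diagram L) (d : dart C) :
    oedge (lk L) :=
  if dsgn (lft d) then (dside d, true) else (side_next (dside d), false).

Lemma corner_image_src (L : complex2) (C : spherical_diagram L) (d : dart C) :
  osrc (corner_image d) = dlab d.
Proof.
rewrite /corner_image dside_lab; case: ifP => //= _.
by rewrite /osrc /= /side_prev /side_next /= ordSK; case: (dside d).
Qed.

Lemma corner_image_tgt (L : complex2) (C : spherical_diagram L) (d : dart C) :
  otgt (corner_image d) = dlab (turn C d).
Proof.
pose p := dopp (turn C d).
have pd : fnext p = d by rewrite /fnext /p doppK permK.
have -> : turn C d = dopp p by rewrite /p doppK.
have lp : lft p = lft d.
  by apply/eqP; rewrite lftP; have := fconnect1 (@fnext C) p; rewrite pd.
have := dside_fnext p; rewrite pd dlab_opp dside_lab lp /corner_image.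
case: ifP => _ ->; rewrite /otgt /= /side_prev /side_next /=.
- by rewrite ordSK; case: (dside p).
- rewrite ord_predK; case: (dside p) => r i.
  by rewrite /linv /= negbK -surjective_pairing.
Qed.

(* The 2-cells [lft d] and [lft e] form a folding pair at the vertex [v]. *)
Definition folding_pair (L : complex2) (C : spherical_diagram L) (v : svert C)
    (d e : dart C) : Prop :=
  [/\ org d = v, org e = v & corner_image d = obar (corner_image e)].

Definition image_in (L : complex2) (n : nat) (K : wedge_subcomplex L n)
    (C : spherical_diagram L) : Prop :=
  (forall d : dart C, edgeK K (dlab d).1 <> None) /\
  (forall c : sface C, cellK K (dcell c) <> None).

Definition vertex_aspherical (L : complex2) (n : nat)
    (K : wedge_subcomplex L n) : Prop :=
  forall C : spherical_diagram L, ~ image_in K C ->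
    exists (v : svert C) (d e : dart C),
      [/\ folding_pair v d e,
          cellK K (dcell (lft d)) = None & cellK K (dcell (lft e)) = None].

(* Main.v *)
Require Import Defs.
From Stdlib Require List.
From mathcomp Require Import all_boot all_order all_algebra all_fingroup.
From mathcomp Require Import reals boolp zify lra.

(** The proof is a Gauss-Bonnet count on the sphere C of a spherical diagram
    whose image is not in K and which has no folding pair in L - K.

    Call a 2-cell of C outer if it is mapped to a 2-cell of L - K, and let V'
    be the set of vertices of C with an outer corner.  The corners around a
    vertex of V' form a cycle of lk(L).  Its outer corners are edges of W(L, K),
    and each corner of a 2-cell over K_i is replaced by e_i, or by nothing when
    its two ends lie on the same side of K_i: the result is a closed walk in
    W(L, K) with an outer corner and with no outer corner run through in both
    directions.  It need not be homology reduced, as it may contain e_i and its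
    inverse, but then it splits into two shorter closed walks of the same total
    weight, since the e_i have weight zero.  By induction its weight is at
    least 2 ([closed_walk_weight]).  Summing over V', the outer corners of C
    have total weight at least 2 |V'|.  On the other hand, by the first
    condition on the weights, their total weight is at most the sum of q - 2
    over the outer 2-cells, q being the number of sides.

    So it suffices that 4 plus the sum of q - 2 over the outer 2-cells is at
    most 2 |V'| ([LKverts_bound]).  Delete from C the edges that have no outer
    2-cell at their sides, so that the 2-cells over K fuse into regions, each
    over a single K_i.  Euler's formula for subgraphs of the sphere
    ([euler_subgraph]) gives the bound as soon as each region has at least two
    sides on its border.  A region without border would be all of C.  If the
    border of a region were a single edge, then this edge would be a loop
    bounding a disc made of 2-cells over K, and an edge of K would be trivial
    in the fundamental group ([boundary1_trivial]), against the hypothesis.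

    The last step is a van Kampen argument without surgery.  Choose words psi(v)
    at the vertices v such that psi(org d) dlab(d) is homotopic to
    psi(org (dopp d)) for as many darts d as possible.  By maximality these
    darts connect all vertices, and a 2-cell over K never has exactly one
    remaining side, because its boundary word is trivial.  By Euler's formula the remaining edges next to the region
    form a forest in the dual graph; in this forest only the node across the
    border edge can be a leaf, which is impossible for a finite forest with an
    edge.  Thus no edge remains, and the label of the border edge, which is a
    loop, is trivial.

    Euler's formula for subgraphs says that deleting edges from the graph of C
    changes the number of vertex components and the number of dual components
    in the way it does in the plane.  One inequality per deleted edge is enough,
    because the two extreme cases are equalities: it is the discrete Jordan
    curve property [cut_dual_connected]. *)

Set Implicit Arguments.
Unset Strict Implicit.
Unset Printing Implicit Defensive.

Import Order.TTheory GRing.Theory Num.Theory.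

Local Open Scope ring_scope.

(** * Components of multigraphs given by darts *)

Section Multigraph.

Local Open Scope nat_scope.
Variables (D : finType) (opp : D -> D).
Hypotheses (oppK : involutive opp) (opp_neq : forall d, opp d != d).

(** Sets of unoriented edges are encoded as sets of darts invariant under [opp],
    so that an edge is counted twice in cardinals. *)
Definition opp_closed (A : {set D}) := forall d, (opp d \in A) = (d \in A).

Lemma opp_closedC A : opp_closed A -> opp_closed (~: A).
Proof. by move=> sA d; rewrite !inE sA. Qed.

Lemma opp_closedU1 A d : opp_closed A -> opp_closed (d |: (opp d |: A)).
Proof.
move=> sA e; rewrite !inE sA (inj_eq (inv_inj oppK)) (can2_eq oppK oppK).
by rewrite orbCA.
Qed.

(** Induction on sets of edges, adding one edge (two darts) at a time. *)
Lemma opp_closed_ind (P : {set D} -> Prop) :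
    P set0 ->
    (forall A d, opp_closed A -> d \notin A -> P A -> P (d |: (opp d |: A))) ->
  forall A, opp_closed A -> P A.
Proof.
move=> P0 PS A; move: {2}#|A|.+1 (ltnSn #|A|) => m.
elim: m A => // m IH A leA sA; have [->|[d dA]] := set_0Vmem A; first by [].
have oA : opp d \in A by rewrite sA.
have eA : A = d |: (opp d |: (A :\ d :\ opp d)).
  by rewrite setD1K ?setD1K // !inE opp_neq.
have sB : opp_closed (A :\ d :\ opp d).
  move=> e; rewrite !inE sA (inj_eq (inv_inj oppK)) (can2_eq oppK oppK).
  by rewrite andbCA.
rewrite eA; apply: PS => //; first by rewrite !inE eqxx andbF.
apply: IH => //; apply: (@leq_trans #|A|) => //.
by apply/proper_card/(sub_proper_trans (subD1set _ _))/properD1.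
Qed.

Section Components.

Variables (T : finType) (o : D -> T).

(** The map [o] sends a dart to its origin.  With [o := org] this is the graph
    of the cell structure, with [o := lft] it is the dual graph. *)
Definition adj (A : {set D}) : rel T :=
  fun x y => [exists d in A, (o d == x) && (o (opp d) == y)].

Definition ncomp (A : {set D}) := #|roots (adj A)|.

Lemma adjI (A : {set D}) d : d \in A -> adj A (o d) (o (opp d)).
Proof. by move=> dA; apply/existsP; exists d; rewrite dA !eqxx. Qed.

Lemma adjP (A : {set D}) x y :
  reflect (exists2 d, d \in A & o d = x /\ o (opp d) = y) (adj A x y).
Proof.
apply: (iffP existsP) => [[d /and3P[dA /eqP<- /eqP<-]]|[d dA [<- <-]]].
  by exists d.
by exists d; rewrite dA !eqxx.
Qed.

Lemma connect_adj_sym A : opp_closed A -> connect_sym (adj A).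
Proof.
move=> sA; apply: sym_connect_sym => x y.
by apply/adjP/adjP=> -[d dA [<- <-]]; exists (opp d); rewrite ?sA ?oppK.
Qed.

(** Connectedness is the least preorder that contains the edges; this replaces
    inductions on paths. *)
Lemma connect_adj_min (A : {set D}) (Q : T -> T -> Prop) :
    (forall x, Q x x) -> (forall x y z, Q x y -> Q y z -> Q x z) ->
    (forall d, d \in A -> Q (o d) (o (opp d))) ->
  forall x y, connect (adj A) x y -> Q x y.
Proof.
move=> Qr Qt QA x y /connectP[p + ->] {y}; elim: p x => //= y p IH x.
by case/andP=> /adjP[d dA [<- <-]] /IH; apply: Qt; apply: QA.
Qed.

Lemma connect_adjS (A B : {set D}) x y :
  A \subset B -> connect (adj A) x y -> connect (adj B) x y.
Proof.
move=> /subsetP AB; apply: (connect_adj_min (Q := connect (adj B))) => //.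
  by move=> ? ? ?; apply: connect_trans.
by move=> d /AB/adjI/connect1.
Qed.

Lemma ncomp_connected A :
  opp_closed A -> (forall x y, connect (adj A) x y) -> ncomp A <= 1.
Proof.
move=> sA cA; apply/card_le1_eqP => x y; rewrite !unfold_in =>
  /eqP ex /eqP ey.
rewrite -ex -ey.
exact/(fingraph.rootP (connect_adj_sym sA)).
Qed.

Lemma ncomp_gt0 A : opp_closed A -> T -> 0 < ncomp A.
Proof.
move=> sA x; apply/card_gt0P; exists (fingraph.root (adj A) x).
exact/roots_root/connect_adj_sym.
Qed.

Lemma ncomp_set0 : ncomp set0 = #|T|.
Proof.
apply: eq_card => x; rewrite !unfold_in.
pose Q (x y : T) := y = x; apply/eqP; suff: Q x (fingraph.root (adj set0) x) by [].
have := connect_root (adj set0) x.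
apply: (connect_adj_min (Q := Q)) => //.
  by move=> ? ? ? -> ->.
by move=> d; rewrite inE.
Qed.

Lemma ncomp_loop A d : opp_closed A ->
  connect (adj A) (o d) (o (opp d)) -> ncomp (d |: (opp d |: A)) = ncomp A.
Proof.
move=> sA cd; have e2 : connect (adj (d |: (opp d |: A))) =2 connect (adj A).
  move=> x y; apply/idP/idP; last first.
    by apply: connect_adjS; apply/subsetP => e eA; rewrite !inE eA !orbT.
  apply: (connect_adj_min (Q := connect (adj A))) => // [? ? ?|e].
    exact: connect_trans.
  rewrite !inE => /or3P[/eqP->|/eqP->|/adjI/connect1] //.
  by rewrite oppK (connect_adj_sym sA).
have e : ncomp =1 fun A => n_comp (adj A) predT.
  by move=> B; apply: eq_card => x; rewrite !inE andbT.
by rewrite !e; apply: eq_n_comp.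
Qed.

(** A new edge fuses at most two components: two components of [A] that do not
    contain the origin of [d] stay distinct. *)
Lemma ncomp_edge A d : opp_closed A ->
  ncomp A <= (ncomp (d |: (opp d |: A))).+1.
Proof.
move=> sA; set A' := _ |: _; have sA' : opp_closed A' by apply: opp_closedU1.
have cS := connect_adj_sym sA; have cS' := connect_adj_sym sA'.
pose x := o d; pose y := o (opp d).
have step z z' : connect (adj A') z z' -> connect (adj A) z z' \/
    (connect (adj A) x z \/ connect (adj A) x z').
  (* A path that uses the new edge does so from one end of it to the other. *)
  suff H : connect (adj A') z z' -> connect (adj A) z z' \/
     (connect (adj A) x z /\ connect (adj A) y z') \/
     (connect (adj A) y z /\ connect (adj A) x z') by move=> /H; tauto.
  apply: (connect_adj_min (Q := fun z z' => connect (adj A) z z' \/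
     (connect (adj A) x z /\ connect (adj A) y z') \/
     (connect (adj A) y z /\ connect (adj A) x z'))) => [u|z1 z2 z3|e].
  - by left.
  - have tr := @connect_trans _ (adj A).
    have sy u v : connect (adj A) u v -> connect (adj A) v u by rewrite cS.
    move=> [h1|[[h1 h1']|[h1 h1']]] [h2|[[h2 h2']|[h2 h2']]].
    all: try by [left; apply: tr h1 h2 | right; left | right; right].
    all: try by right; left; split; [apply: tr h2 (sy _ _ h1)|].
    all: try by right; right; split; [apply: tr h2 (sy _ _ h1)|].
    all: try by right; left; split; [|apply: tr h1' h2].
    all: try by right; right; split; [|apply: tr h1' h2].
    all: try by left; apply: tr (sy _ _ h1) h2'.
  - rewrite /A' !inE => /or3P[/eqP->|/eqP->|/adjI/connect1]; last by left.
      by right; left.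
    by right; right; rewrite oppK.
pose S := [set z in roots (adj A) | z != fingraph.root (adj A) x].
have -> : ncomp A = #|S|.+1.
  rewrite /ncomp (cardD1 (fingraph.root (adj A) x)).
  rewrite [_ \in _]roots_root //= add1n.
  by congr _.+1; apply: eq_card => z; rewrite !inE andbC.
rewrite ltnS -(card_in_imset (f := fingraph.root (adj A'))).
  by apply/subset_leq_card/subsetP=> _ /imsetP[z _ ->]; apply: roots_root.
have nS z : z \in S -> ~ connect (adj A) x z.
  rewrite inE => /andP[/eqP zr /eqP zx] /(fingraph.rootP cS) e.
  by case: zx; rewrite e zr.
move=> z z' zS z'S /(fingraph.rootP cS')/step[|[/nS|/nS]] //.
move: zS z'S; rewrite !inE => /andP[/eqP zr _] /andP[/eqP zr' _].
by move/(fingraph.rootP cS); rewrite zr zr'.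
Qed.

Definition touched (A : {set D}) := o @: A.

(** Each isolated vertex is a component, and the edges make at least one more. *)
Lemma ncomp_touched A : opp_closed A -> A != set0 ->
  #|T| < ncomp A + #|touched A|.
Proof.
move=> sA /set0Pn[d dA]; have cS := connect_adj_sym sA.
have iso z : z \notin touched A -> fingraph.root (adj A) z = z.
  move=> zA; pose Q x y := x = y \/ (x \in touched A /\ y \in touched A).
  suff [<- //|[zA' _]] : Q z (fingraph.root (adj A) z) by rewrite zA' in zA.
  apply: (connect_adj_min (Q := Q)) (connect_root (adj A) z) => [u|u v t|e eA].
  - by left.
  - by rewrite /Q => -[->|[? ?]] [<-|[? ?]]; tauto.
  - by right; rewrite !imset_f // sA.
have: #|fingraph.root (adj A) (o d) |: ~: touched A| <= ncomp A.
  apply/subset_leq_card/subsetP=> z; rewrite in_setU1 inE.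
  case/orP=> [/eqP->|/iso e]; first exact: roots_root.
  by rewrite unfold_in e.
rewrite cardsU1 inE negbK.
have -> : fingraph.root (adj A) (o d) \in touched A.
  pose Q x y := x \in touched A -> y \in touched A.
  suff: Q (o d) (fingraph.root (adj A) (o d)) by apply; apply: imset_f.
  have c := connect_root (adj A) (o d).
  apply: (connect_adj_min (Q := Q)) c => [u|u v t|e eA _].
  - exact: id.
  - by move=> h1 h2 hu; apply: h2 (h1 hu).
  by apply: imset_f; rewrite sA.
have := cardsC (touched A); lia.
Qed.

End Components.

End Multigraph.

(** * Euler's formula for subgraphs of a cellulated sphere *)

Section SphereEuler.

Local Open Scope nat_scope.
Variable C : sphere.
Implicit Types (d e : dart C) (A B : {set dart C}).

Notation opp := (@dopp C).
Notation oppK := (@doppK C).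
Notation opp_neq := (@dopp_neq C).
Notation org := (@org C).
Notation lft := (@lft C).
Notation fnext := (@fnext C).

Lemma turn_fnext d : turn C (fnext d) = opp d.
Proof. by rewrite /fnext permKV. Qed.

Lemma fnext_opp_turn d : fnext (opp (turn C d)) = d.
Proof. by rewrite /fnext oppK permK. Qed.

Lemma org_turn d : org (turn C d) = org d.
Proof. by apply/esym/eqP; rewrite orgP fconnect1. Qed.

Lemma lft_fnext d : lft (fnext d) = lft d.
Proof. by apply/esym/eqP; rewrite lftP (fconnect1 (@Defs.fnext C)). Qed.

Lemma org_fnext d : org (fnext d) = org (opp d).
Proof. by rewrite -turn_fnext org_turn. Qed.

Lemma lft_opp_turn d : lft (opp (turn C d)) = lft d.
Proof. by rewrite -{2}(fnext_opp_turn d) lft_fnext. Qed.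

Lemma fnext_inj : injective fnext.
Proof. by move=> d e /perm_inj/(inv_inj oppK). Qed.

(** The border of [U] is a cycle, so it leaves [S] as often as it enters [S].
    Along each 2-cell of [U] the origins of the sides are, in another order, also
    their ends ([fnext] permutes the sides), and a side inside [U] is the
    opposite of another one. *)
Lemma boundary_cut (U : {set sface C}) (S : {set svert C}) :
  #|[set a | [&& lft a \in U, lft (opp a) \notin U & org a \in S]]| =
  #|[set a | [&& lft a \in U, lft (opp a) \notin U & org (opp a) \in S]]|.
Proof.
pose I := [set a | lft (opp a) \in U].
pose M := [set a | (lft a \in U) && (org a \in S)].
pose N := [set a | (lft a \in U) && (org (opp a) \in S)].
have eMN : #|N| = #|M|.
  rewrite -(card_preimset M fnext_inj); apply: eq_card => a.
  by rewrite !inE lft_fnext org_fnext.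
have eI : #|N :&: I| = #|M :&: I|.
  rewrite -(card_preimset (M :&: I) (inv_inj oppK)); apply: eq_card => a.
  by rewrite !inE oppK andbAC; case: (lft a \in U); rewrite ?andbF ?andbT.
move: eMN; rewrite -(cardsID I N) -(cardsID I M) eI => /addnI/esym e.
transitivity #|M :\: I|; [|rewrite e]; apply: eq_card => a; rewrite !inE;
  by rewrite andbCA.
Qed.

Hypothesis d0 : dart C.

Lemma vertices_connected u v : connect (adj opp org setT) u v.
Proof.
have := sphere_connected u v; apply: connect_sub => x y /existsP[d].
by case/andP=> /eqP<- /eqP<-; apply/connect1/adjI.
Qed.

(** The 2-cells around a vertex are successive neighbours, and so are those along
    a path of the connected graph of the cell structure. *)
Lemma faces_connected f g : connect (adj opp lft setT) f g.
Proof.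
have cS : connect_sym (adj opp lft setT).
  by apply: (connect_adj_sym oppK) => d; rewrite !inE.
pose Q u v := forall d e, org d = u -> org e = v ->
  connect (adj opp lft setT) (lft d) (lft e).
have Qrefl u : Q u u.
  move=> d e <- /esym/eqP; rewrite orgP => /iter_findex <-.
  elim: (findex _ _ _) => //= m IH; apply: connect_trans IH _.
  set a := iter _ _ _; rewrite -lft_opp_turn; apply: connect1.
  by rewrite -{2}(oppK (turn C a)); apply: adjI.
have [d <-] := lft_surj d0 f; have [e <-] := lft_surj d0 g.
suff H : Q (org d) (org e) by apply: H.
apply: (connect_adj_min (Q := Q)) (vertices_connected _ _) => // [u v t|a _].
  have [a au|] := pickP [pred a | org a == v].
    move=> h1 h2 b c bu ct; apply: connect_trans (h1 b a bu (eqP au)) _.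
    exact: h2 (eqP au) ct.
  move=> nv h1 h2 b c bu ct.
  have := vertices_connected v (org d0).
  case/connectP=> [[|x p]] /=.
    by move=> _ e'; have := nv d0; rewrite /= e' eqxx.
  by case/andP=> /adjP[a _ [av _]]; have := nv a; rewrite /= av eqxx.
move=> b c bo co; apply: connect_trans (Qrefl _ b a bo erefl) _.
apply: connect_trans (connect1 (adjI _ _ (in_setT a))) _.
exact: Qrefl _ (opp a) c erefl co.
Qed.

(** Jordan curve property: if [d] joins distinct components of [A], the edges
    leaving the component of its origin cross a closed curve of the dual graph.
    Hence the 2-cells at the two sides of [d] can be joined without crossing [d]
    or [A]; otherwise [d] would be the only edge between this component and its
    complement on the border of some set of 2-cells. *)
Lemma cut_dual_connected A d : opp_closed opp A -> d \notin A ->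
    ~~ connect (adj opp org A) (org d) (org (opp d)) ->
  connect (adj opp lft (~: (d |: (opp d |: A)))) (lft d) (lft (opp d)).
Proof.
move=> sA dA nc; set B := ~: _.
have sB : opp_closed opp B by exact: opp_closedC (opp_closedU1 oppK _ sA).
apply: contraT => nB.
pose S := [set z | connect (adj opp org A) (org d) z].
pose X := [set f | connect (adj opp lft B) (lft d) f].
have dX : lft d \in X by rewrite inE.
have dX' : lft (opp d) \notin X by rewrite inE.
have bX a : lft a \in X -> lft (opp a) \notin X -> (a \in A) || (a == d).
  move=> aX aX'; apply: contraT; rewrite negb_or => /andP[aA ad].
  suff: lft (opp a) \in X by rewrite (negPf aX').
  rewrite inE in aX; rewrite inE.
  apply: (connect_trans aX); apply: connect1 (adjI _ _ _).
  rewrite !inE (negPf aA) (negPf ad) !orbF /=.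
  by apply: contraNneq dX' => <-; rewrite inE.
have AS a : a \in A -> (org a \in S) = (org (opp a) \in S).
  move=> aA; rewrite !inE.
  have cS := connect_adj_sym oppK org sA.
  exact: (same_connect_r cS (connect1 (adjI _ _ aA))).
have := boundary_cut X S; set M := [set a | _]; set N := [set a | _].
suff -> : M = d |: N.
  rewrite cardsU1 inE dX dX' [org (opp d) \in S]inE (negPf nc) /=; lia.
have mM a : (a \in M) = [&& lft a \in X, lft (opp a) \notin X & org a \in S].
  by rewrite /M in_set.
have mN a :
    (a \in N) = [&& lft a \in X, lft (opp a) \notin X & org (opp a) \in S].
  by rewrite /N in_set.
apply/setP=> a; rewrite in_setU1 mM mN.
have [->|ad] /= := eqVneq a d; first by rewrite dX dX' inE connect0.
have := bX a; case: (lft a \in X) => //=; case: (lft (opp a) \in X) => //=.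
by rewrite (negPf ad) orbF => /(_ isT isT)/AS.
Qed.

Notation ncompV := (ncomp opp org).
Notation ncompF := (ncomp opp lft).

(** Adding an edge to [A] either closes a cycle, and the dual graph may lose a
    connection, or joins two components, and the dual graph loses none. *)
Lemma euler_step A d : opp_closed opp A -> d \notin A ->
  ncompF (~: (d |: (opp d |: A))) + ncompV A <=
  ncompF (~: A) + ncompV (d |: (opp d |: A)) + 1.
Proof.
move=> sA dA; set A' := _ |: _; set B := ~: A'.
have sB : opp_closed opp B by exact: opp_closedC (opp_closedU1 oppK _ sA).
have -> : ~: A = d |: (opp d |: B).
  apply/setP=> a; rewrite !inE !negb_or.
  have [->|_] //= := eqVneq a d; have [->|//] := eqVneq a (opp d).
  by rewrite sA.
case: (boolP (connect (adj opp org A) (org d) (org (opp d)))) => c.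
  by rewrite (ncomp_loop oppK sA c); have := ncomp_edge oppK lft d sB; lia.
rewrite (ncomp_loop oppK sB); last exact: cut_dual_connected.
by have := ncomp_edge oppK org d sA; rewrite -/A'; lia.
Qed.

Lemma euler_mono A B : opp_closed opp A -> opp_closed opp B ->
  2 * ncompF (~: (A :|: B)) + #|A| + 2 * ncompV A <=
  2 * ncompF (~: A) + #|A :|: B| + 2 * ncompV (A :|: B).
Proof.
move=> sA sB; move: B sB A sA.
apply: (opp_closed_ind oppK opp_neq) => [A|B d sB dB IH A sA].
  by rewrite setU0; lia.
have -> : A :|: (d |: (opp d |: B)) = (d |: (opp d |: A)) :|: B.
  by apply/setP=> a; rewrite !inE; do !case: (_ == _); rewrite ?orbT.
have := IH _ (opp_closedU1 oppK d sA); set A' := d |: _.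
suff : 2 * ncompF (~: A') + #|A| + 2 * ncompV A <=
       2 * ncompF (~: A) + #|A'| + 2 * ncompV A' by lia.
have [dA|dA] := boolP (d \in A).
  suff -> : A' = A by lia.
  by apply/setP=> a; rewrite !inE; have [->|_] := eqVneq a d;
    rewrite ?dA //=; have [->|] := eqVneq a (opp d); rewrite // sA.
have := euler_step sA dA; rewrite -/A'.
suff -> : #|A'| = #|A|.+2 by lia.
by rewrite /A' !cardsU1 !inE sA (negPf dA) eq_sym (negPf (opp_neq d)).
Qed.

Lemma card_opp_closed_even A : opp_closed opp A -> ~~ odd #|A|.
Proof.
move: A; apply: (opp_closed_ind oppK opp_neq) => [|A d sA dA].
  by rewrite cards0.
by rewrite !cardsU1 !inE sA (negPf dA) eq_sym (negPf (opp_neq d)) /= negbK.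
Qed.

(** Components of the graph and of the dual graph behave as in the plane.  The
    difference of the two sides is monotone in [A] by [euler_mono] and vanishes
    both for no edges, as the dual graph is connected, and for all edges, by
    Euler's formula for the sphere. *)
Lemma euler_subgraph A : opp_closed opp A ->
  2 * ncompF (~: A) + 2 * #|svert C| = #|A| + 2 * ncompV A + 2.
Proof.
move=> sA; have s0 : opp_closed opp set0 by move=> d; rewrite !inE.
have sT : opp_closed opp setT by move=> d; rewrite !inE.
have := euler_mono s0 sA; have := euler_mono sA (opp_closedC sA).
rewrite setUCr set0U setCT setC0 cards0 cardsT !ncomp_set0.
have := ncomp_connected oppK sT faces_connected.
have := ncomp_connected oppK sT vertices_connected.
have := ncomp_gt0 oppK _ sT (org d0); have := ncomp_gt0 oppK _ sT (lft d0).
have := card_opp_closed_even sT; rewrite cardsT; have := sphere_euler C; lia.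
Qed.

End SphereEuler.

(** * Words up to homotopy in K *)

Section Words.

Variables (L : complex2) (n : nat) (K : wedge_subcomplex L n).
Implicit Types (a : letter L) (u v p q : seq (letter L)).

Lemma linvK : involutive (@linv L).
Proof. by case=> x s; rewrite /linv /= negbK. Qed.

Definition Kletter a := edgeK K a.1 != None.

(** Letters outside K are erased first: [homotopicK] cancels letters of K only,
    whereas for [khom] every word is invertible, so that words modulo [khom] are
    the fundamental group of K. *)
Definition khom u v := homotopicK K (filter Kletter u) (filter Kletter v).

Definition winv u := rev (map (@linv L) u).

Lemma homotopicK_ctx p q u v :
  homotopicK K u v -> homotopicK K (p ++ u ++ q) (p ++ v ++ q).
Proof.
elim=> [w|w w' _|w w' w'' _ h1 _ h2|w w' a aK|w w' r rK].
- exact: homotopicK_refl.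
- exact: homotopicK_sym.
- exact: homotopicK_trans h1 h2.
- have := homotopicK_cancel (p ++ w) (w' ++ q) aK.
  by rewrite -!catA.
- have := homotopicK_cell (p ++ w) (w' ++ q) rK.
  by rewrite -!catA.
Qed.

Lemma khom_refl u : khom u u. Proof. exact: homotopicK_refl. Qed.
Lemma khom_sym u v : khom u v -> khom v u. Proof. exact: homotopicK_sym. Qed.
Lemma khom_trans v u w : khom u v -> khom v w -> khom u w.
Proof. exact: homotopicK_trans. Qed.

Lemma khom_cat u u' v v' : khom u u' -> khom v v' -> khom (u ++ v) (u' ++ v').
Proof.
rewrite /khom !filter_cat => hu hv.
apply: (homotopicK_trans (v := filter Kletter u' ++ filter Kletter v)).
  exact: homotopicK_ctx [::] _ _ _ hu.
by have := homotopicK_ctx (filter Kletter u') [::] hv; rewrite !cats0.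
Qed.

Lemma winvK u : winv (winv u) = u.
Proof. by rewrite /winv map_rev revK mapK //; apply: linvK. Qed.

Lemma khom_winv u : khom (u ++ winv u) [::].
Proof.
elim/last_ind: u => [|u a IH]; first exact: khom_refl.
apply: khom_trans IH; rewrite /winv map_rcons rev_rcons -cats1 -catA /=.
rewrite /khom !filter_cat /= (_ : Kletter (linv a) = Kletter a) //.
have [aK|_] := boolP (Kletter a); last exact: homotopicK_refl.
exact: homotopicK_cancel (elimN eqP aK).
Qed.

Lemma khom_winvl u : khom (winv u ++ u) [::].
Proof. by have := khom_winv (winv u); rewrite winvK. Qed.

Lemma khom_catIl p u v : khom (p ++ u) (p ++ v) -> khom u v.
Proof.
have e w : khom (winv p ++ p ++ w) w.
  by rewrite catA; apply: khom_cat (khom_winvl p) (khom_refl w).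
move=> h; apply: khom_trans (khom_sym (e u)) _; apply: khom_trans (e v).
exact: khom_cat (khom_refl _) h.
Qed.

Lemma khom_catIr p u v : khom (u ++ p) (v ++ p) -> khom u v.
Proof.
have e w : khom ((w ++ p) ++ winv p) w.
  by rewrite -catA -{2}(cats0 w); apply: khom_cat (khom_refl w) (khom_winv p).
move=> h; apply: khom_trans (khom_sym (e u)) _; apply: khom_trans (e v).
exact: khom_cat h (khom_refl _).
Qed.

Lemma khom_catC u v : khom (u ++ v) [::] -> khom (v ++ u) [::].
Proof.
move=> h; apply: (khom_catIr (p := v)); rewrite -catA /=.
by rewrite -{3}(cats0 v); apply: khom_cat (khom_refl _) h.
Qed.

Lemma khom_rot k u : khom u [::] -> khom (rot k u) [::].
Proof. by rewrite -{1}(cat_take_drop k u) => /khom_catC. Qed.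

Lemma khom_winv_nil u : khom u [::] -> khom (winv u) [::].
Proof.
move=> h; apply: (khom_catIl (p := u)); rewrite cats0.
exact: khom_trans (khom_winv u) (khom_sym h).
Qed.

Lemma Kletter_bdry r : cellK K r != None -> all Kletter (bdry r).
Proof.
case e: (cellK K r) => [j|//] _; apply/(@all_tnthP _ _ _ (in_tuple _)) => i.
by rewrite /Kletter (cellK_bdry (c := mkside i) e).
Qed.

Lemma khom_bdry r : cellK K r != None -> khom (bdry r) [::].
Proof.
move=> rK; rewrite /khom (all_filterP (Kletter_bdry rK)).
by have := homotopicK_cell [::] [::] (elimN eqP rK); rewrite cats0.
Qed.

Lemma edges_nontrivial_khom a :
  edges_nontrivial K -> Kletter a -> ~ khom [:: a] [::].
Proof.
case: a => x s hK xK h; apply: (hK x (elimN eqP xK)).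
have xK1 : Kletter (x, true) := xK.
suff: khom [:: (x, true)] [::] by rewrite /khom /= xK1.
by case: s xK h => // xK /khom_winv_nil.
Qed.

End Words.

(** * Boundary words of the 2-cells of a spherical diagram *)

Section FaceWords.

Variables (L : complex2) (n : nat) (K : wedge_subcomplex L n).
Variable C : spherical_diagram L.

Lemma khom_dlab_opp (d : dart C) : khom K [:: dlab d; dlab (dopp d)] [::].
Proof. by rewrite dlab_opp; apply: (khom_winv K [:: dlab d]). Qed.

Notation orbit := fingraph.orbit.
Notation order := fingraph.order.

Lemma order_fnext (d : dart C) :
  order (@fnext C) d = size (bdry (dcell (lft d))).
Proof.
rewrite -dcell_size; apply: eq_card => e.
by rewrite !inE -lftP eq_sym.
Qed.

Lemma mkseq_rot (T : Type) (x : T) (s : seq T) i : (i <= size s)%N ->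
  mkseq (fun k => nth x s ((i + k) %% size s)) (size s) = rot i s.
Proof.
move=> is_; apply: (@eq_from_nth _ x) => [|k]; rewrite size_mkseq ?size_rot //.
move=> ks; rewrite nth_mkseq // nth_cat size_drop nth_drop.
case: ltnP => h; first by rewrite modn_small //; lia.
rewrite nth_take; last lia; congr nth.
by rewrite (_ : i + k = (k - (size s - i)) + size s)%N ?modnDr ?modn_small; lia.
Qed.

Lemma dside_mk (d : dart C) :
  exists j : 'I_(size (bdry (dcell (lft d)))), dside d = mkside j.
Proof. by case: (dside d) (dside_cell d) => r j /= <-; exists j. Qed.

Lemma lft_iter (d : dart C) k : lft (iter k (@fnext C) d) = lft d.
Proof. by elim: k => //= k; rewrite lft_fnext. Qed.

(** Walking around a 2-cell of the sphere is walking around its image, forwards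
    or backwards according to [dsgn]. *)
Lemma dside_iter (d : dart C) (r := dcell (lft d)) (j : 'I_(size (bdry r))) k :
    dside d = mkside j ->
  exists2 i : 'I_(size (bdry r)), dside (iter k (@fnext C) d) = mkside i &
   if dsgn (lft d) then i = j + k %[mod size (bdry r)]
   else i + k = j %[mod size (bdry r)].
Proof.
move=> dj; elim: k => [|k [i di ik]].
  by exists j => //; rewrite addn0; case: ifP.
rewrite iterS dside_fnext lft_iter di; move: ik.
case: ifP => _ ik; [exists (ordS i)|exists (ord_pred i)] => //=.
  by rewrite modn_mod addnS -addn1 -modnDml ik modnDml addn1.
rewrite modnDml addnS -addSn prednK; last by have := ltn_ord i; lia.
by rewrite -addnA [(_ + k)%N]addnC addnA modnDr.
Qed.

Lemma dlab_orbit (d : dart C) (r := dcell (lft d)) :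
  exists k, map (@dlab L C) (orbit (@fnext C) d) =
    if dsgn (lft d) then rot k (bdry r) else winv (rot k (bdry r)).
Proof.
have [j dj] := dside_mk d; set q := size (bdry r).
have jq : (j < q)%N by exact: ltn_ord.
pose x := dlab d.
have lab k : (k < q)%N -> exists2 i, (i < q)%N /\
    dlab (iter k (@fnext C) d) = (if dsgn (lft d) then nth x (bdry r) i
                                 else linv (nth x (bdry r) i)) &
    if dsgn (lft d) then i = j + k %[mod q] else i + k = j %[mod q].
  move=> kq; have [i di ik] := dside_iter k dj; exists (val i) => //.
  split; first exact: ltn_ord.
  by rewrite dside_lab lft_iter di /side_letter /= (tnth_nth x).
have so : size (map (@dlab L C) (orbit (@fnext C) d)) = q.
  by rewrite size_map size_orbit order_fnext.
have nth_orb k : (k < q)%N ->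
    nth x (map (@dlab L C) (orbit (@fnext C) d)) k = dlab (iter k (@fnext C) d).
  by move=> kq; rewrite (nth_map d) ?nth_traject // ?size_orbit order_fnext.
(* Read backwards, the word starting at the side j is the inverse of the one
   that ends with this side, that is, starts at the side after it. *)
exists (if dsgn (lft d) then val j else j.+1).
apply: (@eq_from_nth _ x) => [|k]; rewrite so.
  by case: ifP; rewrite ?size_rev ?size_map size_rot.
move=> kq; rewrite nth_orb //; have [i [iq ->] ik] := lab k kq.
case: ifP ik => _ ik.
  rewrite -(mkseq_rot x) ?nth_mkseq -/q ?(ltnW jq) //.
  by rewrite -ik modn_small.
rewrite /winv nth_rev ?size_map ?size_rot //.
rewrite (nth_map x) ?size_rot -/q; last lia.
rewrite -(mkseq_rot x) // nth_mkseq -/q; last lia.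
congr (linv (nth _ _ _)).
rewrite (modn_small jq) in ik.
have [ikq|ikq] := ltnP (i + k) q.
  rewrite modn_small // in ik.
  by rewrite (_ : j.+1 + (q - k.+1) = i + q)%N ?modnDr ?modn_small; lia.
have e : (i + k = j + q)%N.
  have := ik; rewrite -[in X in X = _](subnK ikq) modnDr modn_small; lia.
rewrite modn_small; move: jq kq iq e; move: (nat_of_ord j);
  by clearbody q; clear; lia.
Qed.

Lemma khom_face (d : dart C) : cellK K (dcell (lft d)) != None ->
  khom K (map (@dlab L C) (orbit (@fnext C) d)) [::].
Proof.
move=> /khom_bdry h; have [k ->] := dlab_orbit d.
by case: ifP => _; [|apply: khom_winv_nil]; apply: khom_rot.
Qed.

End FaceWords.

(** * Regions over K bounded by a single edge *)

Section Gauge.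

Local Open Scope nat_scope.
Variables (L : complex2) (n : nat) (K : wedge_subcomplex L n).
Variable C : spherical_diagram L.
Notation opp := (@dopp C).
Notation oppK := (@doppK C).
Notation org := (@org C).
Notation lft := (@lft C).
Notation fnext := (@fnext C).
Notation khom := (@khom L n K).
Notation orbit := fingraph.orbit.

Definition potential := svert C -> seq (letter L).
Implicit Types (psi : potential).

(** A dart is gauged if its label becomes trivial when the labels are changed by
    conjugation with the words of the potential at its ends. *)
Definition gauged psi : {set dart C} :=
  [set d | `[< khom (psi (org d) ++ [:: dlab d]) (psi (org (opp d))) >]].

Lemma gaugedP psi d :
  reflect (khom (psi (org d) ++ [:: dlab d]) (psi (org (opp d))))
    (d \in gauged psi).
Proof. by rewrite inE; apply: asboolP. Qed.

Lemma gauged_opp psi : opp_closed opp (gauged psi).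
Proof.
have H d : d \in gauged psi -> opp d \in gauged psi.
  move=> /gaugedP h; apply/gaugedP; rewrite oppK.
  apply: (khom_trans (v := (psi (org d) ++ [:: dlab d]) ++ [:: dlab (opp d)])).
    by apply: khom_cat (khom_refl _ _); apply: khom_sym.
  rewrite -catA -[X in khom _ X]cats0; apply: khom_cat (khom_refl _ _) _.
  exact: khom_dlab_opp.
by move=> d; apply/idP/idP => /H; rewrite ?oppK.
Qed.

Lemma maximal_gauge : exists psi, forall psi', #|gauged psi'| <= #|gauged psi|.
Proof.
pose P m := `[< exists psi, #|gauged psi| = m >].
have P0 : exists m, P m by exists #|gauged (fun=> [::])|; apply/asboolP; eexists.
have Pb m : P m -> m <= #|dart C| by move=> /asboolP[psi <-]; apply: max_card.
case: (ex_maxnP P0 Pb) => m /asboolP[psi <-] mx; exists psi => psi'.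
by apply: mx; apply/asboolP; eexists.
Qed.

(** Otherwise a dart leads from a component of the gauged darts to another one;
    a common left factor on the complement of the first component gauges it
    without spoiling any gauged dart. *)
Lemma maximal_gauge_connected psi :
    (forall psi', #|gauged psi'| <= #|gauged psi|) ->
  forall u v, connect (adj opp org (gauged psi)) u v.
Proof.
move=> mx u v; set A := gauged psi.
have cS := connect_adj_sym oppK org (gauged_opp psi).
suff H d : connect (adj opp org A) (org d) (org (opp d)).
  by apply: (connect_adj_min (Q := connect (adj opp org A)))
    (vertices_connected u v) => // ? ? ?; apply: connect_trans.
apply: contraT => nd; pose S w := connect (adj opp org A) (org d) w.
pose g := (psi (org d) ++ [:: dlab d]) ++ winv (psi (org (opp d))).
pose psi' w := if S w then psi w else g ++ psi w.
suff: A \proper gauged psi' by move/proper_card; have := mx psi'; rewrite -/A; lia.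
apply/properP; split.
  apply/subsetP=> e eA; have := eA; move/gaugedP => h; apply/gaugedP.
  have e2 : S (org e) = S (org (opp e)).
    exact: (same_connect_r cS (connect1 (adjI _ _ eA))).
  rewrite /psi' -e2; case: (S _) => //.
  by rewrite -catA; apply: khom_cat (khom_refl _ _) h.
exists d; last first.
  by apply: contra nd => dA; apply: connect1 (adjI _ _ dA).
apply/gaugedP; rewrite /psi' {1}/S connect0 /S (negPf nd).
rewrite /g -catA; apply: khom_sym.
rewrite -[X in khom _ X]cats0; apply: khom_cat (khom_refl _ _) _.
exact: khom_winvl.
Qed.

(** The boundary word is trivial, so the last side of a 2-cell is gauged if all
    the other ones are. *)
Lemma gauged_face psi d :
    khom (map (@dlab L C) (orbit fnext d)) [::] ->
    (forall e, e \in orbit fnext d -> e != d -> e \in gauged psi) ->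
  d \in gauged psi.
Proof.
rewrite /fingraph.orbit -orderSpred /= => hd ge; apply/gaugedP.
have uo := orbit_uniq fnext d; rewrite /fingraph.orbit -orderSpred /= in uo.
(* A path of gauged darts transports the potential. *)
have walk m x : (forall e, e \in traject fnext x m -> e \in gauged psi) ->
    khom (psi (org x) ++ map (@dlab L C) (traject fnext x m))
        (psi (org (iter m fnext x))).
  elim: m x => [|m IH] x gx; first by rewrite cats0; apply: khom_refl.
  rewrite iterSr /= -cat1s catA; apply: khom_trans (IH _ _); last first.
    by move=> e et; apply: gx; rewrite /= inE et orbT.
  apply: khom_cat (khom_refl _ _); rewrite org_fnext; apply/gaugedP/gx.
  by rewrite inE eqxx.
set m := (fingraph.order fnext d).-1 in hd ge uo.
have {walk} := walk m (fnext d).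
rewrite -iterSr orderSpred iter_order; last exact: fnext_inj.
rewrite org_fnext => h.
set w := map _ _ in hd h.
have {}h : khom (psi (org (opp d)) ++ w) (psi (org d)).
  apply: h => e et; apply: ge; first by rewrite inE et orbT.
  by case/andP: uo => nd _; apply: contraNneq nd => ed; rewrite -{1}ed.
apply: (khom_catIr (p := w)); apply: khom_trans (khom_sym h).
by rewrite -catA /= -[X in khom _ X]cats0; apply: khom_cat (khom_refl _ _) hd.
Qed.

(** Simple connectedness of a region with a single side [d0] on its border.  For
    a maximal potential suppose that [d0] is not gauged.  The ungauged edges [B]
    at the sides of the region form a dual forest, because their complement
    connects all vertices.  The nodes of this forest are 2-cells of the region,
    of degree at least 2 by [gauged_face], and the 2-cell across [d0], of degree
    at least 1: a forest has too few edges for this. *)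
Lemma boundary1_trivial (U : {set sface C}) d0 :
    (forall d, lft d \in U -> khom (map (@dlab L C) (orbit fnext d)) [::]) ->
    (forall d, (lft d \in U) && (lft (opp d) \notin U) = (d == d0)) ->
  khom [:: dlab d0] [::].
Proof.
move=> hU bU; have := bU d0; rewrite eqxx => /andP[d0U d0U'].
(* The border of the region is a cycle, so d0 ends where it starts. *)
have loop : org (opp d0) = org d0.
  have := boundary_cut U [set org d0].
  set M := [set a | _]; set N := [set a | _].
  have -> : M = [set d0].
    apply/setP=> a; rewrite !inE andbA bU.
    by case: eqVneq => // ->; rewrite eqxx.
  rewrite cards1; apply: contra_eq => ne.
  suff -> : N = set0 by rewrite cards0.
  apply/setP=> a; rewrite !inE andbA bU.
  by case: eqVneq => // ->; rewrite (negPf ne).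
have [psi mx] := maximal_gauge; set A := gauged psi.
suff: d0 \in A.
  move/gaugedP; rewrite loop => h.
  by apply: (khom_catIl (p := psi (org d0))); rewrite cats0.
apply: contraT => d0A.
pose B := [set d | (d \notin A) && ((lft d \in U) || (lft (opp d) \in U))].
have sA : opp_closed opp A := gauged_opp psi.
have inB d :
    (d \in B) = (d \notin A) && ((lft d \in U) || (lft (opp d) \in U)).
  by rewrite in_set.
have sB : opp_closed opp B by move=> d; rewrite !inB sA oppK orbC.
have AB : A \subset ~: B by apply/subsetP=> d dA; rewrite in_setC inB dA.
have cB : ncomp opp org (~: B) <= 1.
  apply: (ncomp_connected oppK); first exact: opp_closedC.
  move=> u v; apply: connect_adjS AB _; exact: maximal_gauge_connected.
have := euler_subgraph d0 (opp_closedC sB); rewrite setCK => eul.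
have B0 : B != set0 by apply/set0Pn; exists d0; rewrite inB d0A d0U.
have := ncomp_touched oppK lft sB B0; set X := touched lft B => iso.
(* The nodes of B outside the region: only the 2-cell across d0. *)
have cX : #|X| <= #|X :&: U|.+1.
  apply: (@leq_trans #|lft (opp d0) |: (X :&: U)|); last first.
    by rewrite cardsU1; case: (_ \notin _).
  apply/subset_leq_card/subsetP=> f fX; rewrite in_setU1 in_setI fX /=.
  have [_|fU] := boolP (f \in U); first by rewrite orbT.
  case/imsetP: fX => b; rewrite inB => /andP[_ bBU] ef; move: bBU fU.
  rewrite ef => /orP[-> //|bU' nU]; have := bU (opp b).
  by rewrite oppK bU' nU => /esym/eqP <-; rewrite oppK eqxx.
(* Sum of the degrees, with the opposite of d0 counted apart. *)
have dX : (#|X :&: U|).*2.+1 <= #|B|.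
  pose BU := [set b in B | lft b \in U].
  have : #|opp d0 |: BU| <= #|B|.
    apply/subset_leq_card/subsetP=> b; rewrite in_setU1 in_set.
    by case/orP=> [/eqP->|/andP[] //]; rewrite inB sA d0A oppK d0U orbT.
  rewrite cardsU1 [_ \in BU]in_set (negPf d0U') andbF /=.
  suff : (#|X :&: U|).*2 <= #|BU| by lia.
  rewrite -[#|BU|]sum1_card (partition_big lft (mem (X :&: U))) /=; last first.
    by move=> b; rewrite in_set in_setI => /andP[bB ->]; rewrite imset_f.
  rewrite -muln2 -sum_nat_const; apply: leq_sum => f.
  rewrite in_setI => /andP[/imsetP[b bB ef] fU]; rewrite sum1_card.
  rewrite ltnNge; apply/negP => /card_le1_eqP one.
  have := bB; rewrite inB => /andP[/negP bA _]; apply: bA; apply: gauged_face.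
    by apply: hU; rewrite -ef.
  move=> e; rewrite -fconnect_orbit -lftP => /eqP eb neb; apply: contraT => eA.
  case/eqP: neb; apply: one.
    by rewrite unfold_in in_set bB -ef fU eqxx.
  by rewrite unfold_in in_set inB eA -eb -ef fU eqxx.
have := sphere_euler C; have := cardsC B.
have := card_opp_closed_even (opp_closedC sB); have := card_opp_closed_even sB.
clear -dX cX iso eul cB.
lia.
Qed.

End Gauge.

(** * Counting the vertices with a corner outside K *)

Section Count.

Local Open Scope nat_scope.
Variables (L : complex2) (n : nat) (K : wedge_subcomplex L n).
Variable C : spherical_diagram L.
Notation opp := (@dopp C).
Notation oppK := (@doppK C).
Notation org := (@org C).
Notation lft := (@lft C).

(** The 2-cells of the sphere that are mapped to L - K. *)
Definition LKface (f : sface C) := cellK K (dcell f) == None.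

(** The edges that stay when the 2-cells over K are fused into regions. *)
Definition LKdarts : {set dart C} :=
  [set a | LKface (lft a) || LKface (lft (opp a))].

Definition LKverts : {set svert C} := org @: LKdarts.

Lemma edgeK_dlab (d : dart C) i :
  cellK K (dcell (lft d)) = Some i -> edgeK K (dlab d).1 = Some i.
Proof.
rewrite -dside_cell => /cellK_bdry e; rewrite dside_lab; by case: ifP => _; exact: e.
Qed.

Lemma LKdarts_opp : opp_closed opp LKdarts.
Proof. by move=> d; rewrite !inE oppK orbC. Qed.

Lemma LKvertsP v :
  reflect (exists2 d, org d = v & LKface (lft d)) (v \in LKverts).
Proof.
apply: (iffP imsetP) => [[d]|[d <- dK]]; last by exists d => //; rewrite inE dK.
rewrite inE => /orP[dK ->|dK ->]; first by exists d.
exists (fnext (opp d)); first by rewrite org_fnext oppK.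
by rewrite lft_fnext.
Qed.

Hypothesis hK : edges_nontrivial K.
Variables (f0 : sface C) (d0 : dart C).
Hypothesis f0K : LKface f0.

Notation region := (fingraph.root (adj opp lft (~: LKdarts))).

Let cS : connect_sym (adj opp lft (~: LKdarts)).
Proof. exact: (connect_adj_sym oppK _ (opp_closedC LKdarts_opp)). Qed.

(** A 2-cell over L - K is a region by itself: all its sides are kept. *)
Lemma region_LKface f g : region f = region g -> LKface f -> f = g.
Proof.
move/(fingraph.rootP cS); pose Q f g := f <> g -> ~~ LKface f /\ ~~ LKface g.
move=> fg fK; suff H : Q f g.
  by have [//|/eqP/H[]] := eqVneq f g; rewrite fK.
apply: (connect_adj_min (Q := Q)) fg => [x|x y z h1 h2|d].
- by move=> nx; case: nx.
- rewrite /Q; have [->|/eqP/h1[xK yK]] := eqVneq x y; first exact: h2.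
  by have [<- _|/eqP/h2[_ zK] _] := eqVneq y z; split.
- by rewrite !inE negb_or => /andP[xK yK] _; split.
Qed.

Definition region_border f := [set d in LKdarts | region (lft d) == f].

(** A region over K without border would contain all 2-cells, and a region with
    a single side on its border would trivialise an edge of K. *)
Lemma region_border_ge2 f : region f = f -> ~~ LKface f ->
  1 < #|region_border f|.
Proof.
move=> rf fK; pose U := [set g | region g == f].
have UK g : g \in U -> ~~ LKface g.
  rewrite inE => /eqP rg; apply: contra fK => gK.
  by rewrite -(region_LKface (etrans rg (esym rf)) gK).
have stay d : d \notin LKdarts -> lft d \in U -> lft (opp d) \in U.
  move=> dA; rewrite !inE => /eqP <-; apply/eqP/(fingraph.rootP cS).
  by rewrite cS; apply: connect1 (adjI _ _ _); rewrite in_setC.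
have inN d : (d \in region_border f) = (d \in LKdarts) && (lft d \in U).
  by rewrite /region_border !in_set.
rewrite ltnNge; apply/negP => le1.
have [N0|[d dN]] := set_0Vmem (region_border f).
  suff f0U : f0 \in U by have := UK f0 f0U; rewrite f0K.
  have := faces_connected d0 f f0; pose Q x y := x \in U -> y \in U.
  move=> c; suff : Q f f0 by apply; rewrite inE rf.
  apply: (connect_adj_min (Q := Q)) c => [x|x y z h1 h2 xU|d _ dU].
  - exact: id.
  - exact: h2 (h1 xU).
  apply: (stay _ _ dU); apply: contraT; rewrite negbK => dA.
  by have := inN d; rewrite N0 inE dA dU.
have Nd e : (e \in region_border f) = (e == d).
  apply/idP/eqP => [eN|-> //].
  by move/card_le1_eqP: le1; apply.
have /andP[dA dU] : (d \in LKdarts) && (lft d \in U) by rewrite -inN.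
apply: (@edges_nontrivial_khom _ _ K (dlab d) hK).
  move: (UK _ dU); rewrite /LKface /Kletter.
  by case e: (cellK K _) => [i|//] _; rewrite (edgeK_dlab e).
apply: (@boundary1_trivial _ _ K C U d).
  by move=> e /UK; apply: khom_face.
move=> e; rewrite -Nd inN; have [eU|] := boolP (lft e \in U); last by rewrite andbF.
rewrite andbT /=; apply/idP/idP => [nU|eA].
  by apply: contraT => /stay/(_ eU); rewrite (negPf nU).
apply/negP => /UK; move: eA; rewrite inE (negPf (UK _ eU)) /=.
by move->.
Qed.

(** Euler's formula for the graph [LKdarts].  Its darts are counted by regions:
    a 2-cell over L - K contributes all its sides, any other region at least 2,
    which compensates its contribution to the number of regions. *)
Lemma LKverts_bound :
  4 + \sum_(f | LKface f) size (bdry (dcell f)) <=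
  2 * #|LKverts| + 2 * #|LKface|.
Proof.
have A0 : LKdarts != set0.
  have [d df] := lft_surj d0 f0.
  by apply/set0Pn; exists d; rewrite inE df f0K.
have := euler_subgraph d0 LKdarts_opp.
have := ncomp_touched oppK org LKdarts_opp A0; rewrite -[touched _ _]/LKverts.
set F' := ncomp _ _ (~: _).
suff : \sum_(f | LKface f) size (bdry (dcell f)) + 2 * F'
        <= #|LKdarts| + 2 * #|LKface| by lia.
have LKroot f : LKface f -> region f = f.
  move=> fK; apply/esym/region_LKface => //; by rewrite root_root.
have -> : F' = \sum_(f | region f == f) 1 by rewrite sum1_card.
have -> : #|LKdarts| = \sum_(f | region f == f) #|region_border f|.
  rewrite -sum1_card (partition_big (fun d => region (lft d))
    (fun f => region f == f)) /=.
    apply: eq_bigr => f _; rewrite -sum1_card.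
    by apply: eq_bigl => d; rewrite !in_set.
  by move=> d _; rewrite root_root.
rewrite !(bigID LKface (fun f => region f == f)) /=.
have e (F : sface C -> nat) :
    \sum_(f | (region f == f) && LKface f) F f = \sum_(f | LKface f) F f.
  apply: eq_bigl => f; case fK: (LKface f); rewrite ?andbF // andbT.
  by apply/eqP/LKroot.
have -> : #|LKface| = \sum_(f | LKface f) 1 by rewrite sum1_card.
rewrite !e.
have : \sum_(f | LKface f) size (bdry (dcell f)) <=
    \sum_(f | LKface f) #|region_border f|.
  apply: leq_sum => f fK; rewrite -dcell_size; apply/subset_leq_card/subsetP.
  move=> d; rewrite !inE => /eqP->; by rewrite fK LKroot // eqxx.
have : 2 * \sum_(f | (region f == f) && ~~ LKface f) 1 <=
    \sum_(f | (region f == f) && ~~ LKface f) #|region_border f|.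
  rewrite big_distrr /=; apply: leq_sum => f /andP[/eqP rf fK].
  exact: region_border_ge2.
by lia.
Qed.

End Count.

(** * Closed walks and their weights *)

Section Walks.

Variable (G : graph).
Implicit Types (x y t : gvert G) (a : oedge G) (z : seq (oedge G)).

(** Membership in walks is [List.In], as the edges of a graph need not have a
    decidable equality. *)
Fixpoint walk x z y : Prop :=
  if z is a :: z' then osrc a = x /\ walk (otgt a) z' y else x = y.

Lemma walk_cat x z1 z2 y :
  walk x (z1 ++ z2) y <-> exists2 t, walk x z1 t & walk t z2 y.
Proof.
elim: z1 x => [|a z1 IH] x /=; first by split=> [|[t ->]] //; exists x.
split=> [[ax /IH[t h1 h2]]|[t [ax h1] h2]]; first by exists t.
by split=> //; apply/IH; exists t.
Qed.

Lemma closed_walk_cycle x z : (0 < size z)%N -> walk x z x -> is_cycle z.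
Proof.
move=> z0 zx; split=> // i; have a0 := tnth (in_tuple z) i.
rewrite !(tnth_nth a0) /=; case: i => k kz /=.
move: (zx); rewrite -{1}(cat_take_drop k z) (drop_nth a0 kz).
case/walk_cat=> t _ /= [_].
have [kz1|kz1] := ltnP k.+1 (size z).
  by rewrite modn_small // (drop_nth a0 kz1) /= => -[->].
rewrite drop_oversize //= (_ : k.+1 = size z); last by apply/eqP; rewrite eqn_leq kz.
rewrite modnn => ->; case: z {kz kz1} z0 zx => //= a z _ [-> _]; reflexivity.
Qed.

Lemma obarK : involutive (@obar G).
Proof. by case=> e s; rewrite /obar /= negbK. Qed.

Lemma osrc_obar a : osrc (obar a) = otgt a.
Proof. by case: a => e []. Qed.

Lemma otgt_obar a : otgt (obar a) = osrc a.
Proof. by case: a => e []. Qed.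

Lemma obar_neq a : obar a <> a.
Proof. by case: a => e [] []. Qed.

Lemma tnth_In (T : Type) (s : seq T) (i : 'I_(size s)) :
  List.In (tnth (in_tuple s) i) s.
Proof.
rewrite (tnth_nth (tnth (in_tuple s) i)) /=; move: (tnth _ i) => x.
elim: s i => [|y s IH] [[|k] //= ks]; first by left.
by right; apply: (IH (Ordinal (ks : k < size s)%N)).
Qed.

Lemma In_cat (T : Type) (a : T) (s t : seq T) :
  List.In a (s ++ t) <-> List.In a s \/ List.In a t.
Proof. exact: List.in_app_iff. Qed.

Lemma In_split (T : Type) (a : T) (s : seq T) :
  List.In a s -> exists l r, s = l ++ a :: r.
Proof. exact: List.in_split. Qed.

Lemma reducible_split z : homology_reducible z ->
  exists a l m r, z = l ++ a :: m ++ obar a :: r.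
Proof.
case=> i [j e]; have := tnth_In i; have := tnth_In j.
rewrite e; move: (tnth _ j) => b hb hb'.
have [l [r ez]] := In_split hb; subst z.
move/In_cat: hb' => [hl|[e'|hr]].
- have [l1 [l2 ->]] := In_split hl.
  by exists (obar b), l1, l2, r; rewrite obarK -catA.
- by case: (obar_neq (esym e')).
- have [m [r' ->]] := In_split hr.
  by exists b, l, m, r'.
Qed.

Variables (R : realType) (w : gedge G -> R).

Lemma weight_cat z1 z2 : weight w (z1 ++ z2) = weight w z1 + weight w z2.
Proof. exact: big_cat. Qed.

Lemma weight_cons a z : weight w (a :: z) = w a.1 + weight w z.
Proof. exact: big_cons. Qed.

Variable Z : gedge G -> Prop.
Hypothesis w0 : forall e, Z e -> w e = 0.
Hypothesis w2 : forall z, is_cycle z -> homology_reduced z -> 2 <= weight w z.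

Lemma weight_null z : (forall a, List.In a z -> Z a.1) -> weight w z = 0.
Proof.
elim: z => [|a z IH] hz; first exact: big_nil.
rewrite weight_cons w0; last by apply: hz; left.
by rewrite IH ?addr0 // => b hb; apply: hz; right.
Qed.

(** Here [Z] is a set of edges of weight zero.  If the walk is not homology
    reduced, it is l b u b^-1 r with b in [Z]; both u and l r are closed walks,
    and one of them runs through an edge outside [Z].  The other one has weight
    at least 2 for the same reason, or else weight zero. *)
Lemma closed_walk_weight x z : walk x z x ->
    (exists2 a, List.In a z & ~ Z a.1) ->
    (forall a, List.In a z -> List.In (obar a) z -> Z a.1) ->
  2 <= weight w z.
Proof.
move: {2}(size z).+1 (ltnSn (size z)) => m.
elim: m x z => // m IH x z zm zx [a az aZ] red.
case: (EM (homology_reducible z)) => [|nr]; last first.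
  by apply: w2 => //; apply: closed_walk_cycle zx; case: z az {zm red nr}.
case/reducible_split=> b [l [u [r ez]]].
have bz : List.In b z by rewrite ez In_cat /=; tauto.
have bz' : List.In (obar b) z by rewrite ez In_cat /= In_cat /=; tauto.
have bZ := red _ bz bz'; subst z.
case/walk_cat: zx => p lp /= [pb /walk_cat[q hu /= [qb hr]]].
rewrite osrc_obar in qb; rewrite otgt_obar pb in hr; subst q.
have hlr : walk x (l ++ r) x by apply/walk_cat; exists p.
have redu c : List.In c u -> List.In (obar c) u -> Z c.1.
  by move=> h h'; apply: red; rewrite In_cat /= In_cat /=; tauto.
have redlr c : List.In c (l ++ r) -> List.In (obar c) (l ++ r) -> Z c.1.
  move=> /In_cat h /In_cat h'.
  by apply: red; rewrite In_cat /= In_cat /=; tauto.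
have alt y v : (size v < m)%N -> walk y v y ->
   (forall c, List.In c v -> List.In (obar c) v -> Z c.1) ->
   weight w v = 0 \/ 2 <= weight w v.
  move=> vm hv rv; case: (EM (exists2 c, List.In c v & ~ Z c.1)) => [h|h].
    by right; apply: IH hv h rv.
  left; apply: weight_null => c cv; apply: contrapT => cZ; apply: h.
  by exists c.
rewrite !size_cat /= size_cat /= in zm.
have su : (size u < m)%N by lia.
have slr : (size (l ++ r) < m)%N by rewrite size_cat; lia.
rewrite weight_cat weight_cons weight_cat weight_cons /= (w0 bZ) !add0r.
rewrite addrCA -weight_cat.
have au : List.In a u \/ List.In a (l ++ r).
  move: az; rewrite !In_cat /= In_cat /=.
  case=> [h|[e|[h|[e|h]]]]; try tauto; subst a; by case: aZ.
case: au => [au|alr].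
  have := IH _ _ su hu (ex_intro2 _ _ a au aZ) redu.
  by case: (alt _ _ slr hlr redlr); lra.
have := IH _ _ slr hlr (ex_intro2 _ _ a alr aZ) redlr.
by case: (alt _ _ su hu redu); lra.
Qed.

End Walks.

(** * The corners of L as walks in W(L, K) *)

Section Lifts.

Variables (L : complex2) (n : nat) (K : wedge_subcomplex L n).

Lemma W_pointK (a : letter L) i :
  edgeK K a.1 = Some i -> W_point K a = W_k K i a.2.
Proof.
move=> ai; rewrite /W_point.
suff H o (e : edgeK K a.1 = o) : o = Some i ->
    match o as o return edgeK K a.1 = o -> W_vert K with
    | Some i => fun _ => W_k K i a.2
    | None => fun h => inl (exist _ a (introT eqP h))
    end e = W_k K i a.2 by exact: H.
by move=> oi; move: e; rewrite oi.
Qed.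

(** A corner outside K is an edge of W(L, K).  A corner of a 2-cell of K_i
    crosses e_i, unless its two ends are both beginnings or both ends of edges.
    The type of [o] carries the proof that the 2-cell is not in K. *)
Definition lift_corner_of (a : oedge (lk L)) o : cellK K (tag a.1) = o ->
    seq (oedge (W K)) :=
  match o as o return cellK K (tag a.1) = o -> seq (oedge (W K)) with
  | None => fun h =>
      [:: (W_corner (r := exist _ (tag a.1) (introT eqP h)) (tagged a.1), a.2)]
  | Some i => fun _ =>
      if (osrc a).2 == (otgt a).2 then [::] else [:: (W_e K i, (osrc a).2)]
  end.

Definition lift_corner a := @lift_corner_of a _ erefl.

Variant lift_spec (a : oedge (lk L)) : seq (oedge (W K)) -> Prop :=
| LiftK i of cellK K (tag a.1) = Some i :
    lift_spec a
      (if (osrc a).2 == (otgt a).2 then [::] else [:: (W_e K i, (osrc a).2)])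
| LiftLK (h : cellK K (tag a.1) == None) :
    lift_spec a
      [:: (W_corner (r := exist _ (tag a.1) h) (tagged a.1) : gedge (W K), a.2)].

Lemma liftP a : lift_spec a (lift_corner a).
Proof.
rewrite /lift_corner; move: (erefl (cellK K (tag a.1))).
by case: {2 3}(cellK K (tag a.1)) => [i|] h; [apply: LiftK|apply: LiftLK].
Qed.

Lemma edgeK_osrc (a : oedge (lk L)) i :
  cellK K (tag a.1) = Some i -> edgeK K (osrc a : letter L).1 = Some i.
Proof.
case: a => c [] h; first exact: cellK_bdry h.
exact: (cellK_bdry (c := side_prev c) h).
Qed.

Lemma edgeK_otgt (a : oedge (lk L)) i :
  cellK K (tag a.1) = Some i -> edgeK K (otgt a : letter L).1 = Some i.
Proof. by rewrite -(osrc_obar a) => h; apply: edgeK_osrc. Qed.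

Lemma walk_lift (a : oedge (lk L)) :
  walk (G := W K) (W_point K (osrc a)) (lift_corner a) (W_point K (otgt a)).
Proof.
case: liftP => [i h|h].
  rewrite (W_pointK (edgeK_osrc h)) (W_pointK (edgeK_otgt h)).
  case: (osrc a) (otgt a) => x s [y t] /=.
  case: eqVneq => [->|] //; by case: s; case: t.
by case: a h => -[r i] [].
Qed.

Definition W_side (e : W_edge K) : option (side L) :=
  if e is inl c then Some (mkside (tagged c)) else None.

Lemma In_lift a p : List.In p (lift_corner a) -> W_side p.1 <> None ->
  [/\ W_side p.1 = Some a.1, p.2 = a.2 & cellK K (tag a.1) == None].
Proof.
case: liftP => [i h|h]; first by case: ifP => _ //= -[<-|].
by move=> /= [<- _|//]; split=> //; case: a h => -[r i] s.
Qed.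

Lemma lift_LK a : cellK K (tag a.1) == None ->
  exists2 p, List.In p (lift_corner a) & W_side p.1 <> None.
Proof.
by case: liftP => [i ->|h _] //; eexists; first by left; reflexivity.
Qed.

Variables (R : realType) (w : gedge (W K) -> R).
Hypothesis w_e : forall i, w (W_e K i) = 0.

(** The weight of a corner of L: zero inside K, see [wcornerK]. *)
Definition wcorner (c : side L) : R := weight w (lift_corner (c, true)).

Lemma weight_lift a : weight w (lift_corner a) = wcorner a.1.
Proof.
rewrite /wcorner; case: liftP => [i h|h].
  case: liftP => [j _|h']; last by exfalso; move: h'; rewrite /= h.
  do !case: ifP => _; by rewrite ?weight_cons /weight ?big_nil /= ?w_e ?addr0.
case: liftP => [j h'|h']; first by exfalso; move: h; rewrite /= h'.
by rewrite /weight !big_seq1 /= (eq_irrelevance h h').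
Qed.

Lemma wcornerK c : cellK K (tag c) != None -> wcorner c = 0.
Proof.
rewrite /wcorner; case: liftP => [j _ _|h]; last by rewrite h.
by case: ifP => _; rewrite ?weight_cons /weight ?big_nil /= ?w_e ?addr0.
Qed.

Lemma wcornerLK (r : cellLK K) (i : 'I_(size (bdry (val r)))) :
  wcorner (mkside i) = w (W_corner i).
Proof.
rewrite /wcorner; case: r i => r h i; case: liftP => [j h'|h'].
  by exfalso; move: (h); rewrite -[r]/(tag (mkside i)) h'.
by rewrite /weight big_seq1 /= (eq_irrelevance h' h).
Qed.

End Lifts.

(** * The weights of the corners of a spherical diagram *)

Section FaceCorners.

Variables (L : complex2) (C : spherical_diagram L).

(** As the sides of a 2-cell of the sphere are as many as those of its image,
    this makes the map on corners a bijection; see [sum_face_corners]. *)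
Lemma corner_position (f : sface C) (d0 : dart C)
    (i : 'I_(size (bdry (dcell f)))) :
  exists d : dart C, lft d = f /\ (corner_image d).1 = mkside i.
Proof.
have [d df] := lft_surj d0 f; subst f; have [j dj] := dside_mk d.
set q := size _ in i j dj *.
have jq := ltn_ord j; have iq := ltn_ord i.
have side_at k (i' : 'I_q) :
    (if dsgn (lft d) then i' = j + k %[mod q] else i' + k = j %[mod q])%N ->
    dside (iter k (@fnext C) d) = mkside i'.
  move=> ik; have [i'' -> ik'] := dside_iter k dj; congr mkside; apply: val_inj.
  have iq' := ltn_ord i'; have iq'' := ltn_ord i''.
  rewrite /= -(modn_small iq') -(modn_small iq'').
  move: ik ik'; case: ifP => _; first by move=> -> ->.
  move=> <- /eqP; rewrite eqn_modDr => /eqP e; exact: e.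
case sd: (dsgn (lft d)).
  exists (iter (i + q - j) (@fnext C) d); split; first exact: lft_iter.
  rewrite /corner_image lft_iter sd; apply: side_at; rewrite sd.
  by rewrite addnC subnK ?modnDr //; lia.
exists (iter (j + q - ord_pred i) (@fnext C) d); split; first exact: lft_iter.
rewrite /corner_image lft_iter sd (side_at _ (ord_pred i)).
  by rewrite /side_next /= ord_predK.
have := ltn_ord (ord_pred i); rewrite sd => h.
by rewrite addnC subnK ?modnDr //; lia.
Qed.

Lemma sum_face_corners (V : nmodType) (F : side L -> V) (f : sface C)
    (d0 : dart C) :
  \sum_(d : dart C | lft d == f) F (corner_image d).1 =
  \sum_(i < size (bdry (dcell f))) F (mkside i).
Proof.
have [s sP] := choice (corner_position d0 (f := f)).
have sinj : injective s.
  move=> i j e; have := (sP i).2; rewrite e (sP j).2.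
  by move=> /(congr1 (fun c : side L => nat_of_ord (tagged c)))/esym/val_inj.
have im : s @: setT = [set d | lft d == f].
  apply/eqP; rewrite eqEcard dcell_size card_imset // cardsT card_ord leqnn.
  rewrite andbT.
  by apply/subsetP=> _ /imsetP[i _ ->]; rewrite inE (sP i).1.
rewrite (eq_bigl (mem (s @: setT))) => [|d]; last by rewrite im !inE.
rewrite big_imset /=; last by move=> ? ? _ _; apply: sinj.
by apply: eq_big => [i|i _]; rewrite ?inE // (sP i).2.
Qed.

End FaceCorners.

Section VertexWalk.

Variables (L : complex2) (n : nat) (K : wedge_subcomplex L n).
Variable C : spherical_diagram L.

(** The image in W(L, K) of [m] successive corners around a vertex. *)
Definition vertex_walk (d : dart C) (m : nat) : seq (oedge (W K)) :=
  flatten [seq lift_corner K (corner_image e) | e <- traject (turn C) d m].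

Lemma walk_vertex d m :
  walk (G := W K) (W_point K (dlab d)) (vertex_walk d m)
    (W_point K (dlab (iter m (turn C) d))).
Proof.
elim: m d => [|m IH] d //=; apply/walk_cat.
exists (W_point K (dlab (turn C d))).
  have := walk_lift K (corner_image d).
  by rewrite corner_image_src corner_image_tgt.
by rewrite -iterS iterSr; apply: IH.
Qed.

Lemma In_vertex_walk d m a : List.In a (vertex_walk d m) <->
  exists2 e, e \in traject (turn C) d m &
             List.In a (lift_corner K (corner_image e)).
Proof.
rewrite /vertex_walk; elim: (traject _ _ _) => [|e s IH] /=.
  by split=> // -[].
rewrite In_cat IH; split=> [[h|[e' es h]]|[e']].
- by exists e; rewrite ?inE ?eqxx.
- by exists e' => //; rewrite inE es orbT.
rewrite inE => /orP[/eqP->|]; first by left.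
by right; exists e'.
Qed.

Variables (R : realType) (w : gedge (W K) -> R).
Hypothesis w_e : forall i, w (W_e K i) = 0.

Lemma weight_vertex_walk d m :
  weight w (vertex_walk d m) =
  \sum_(e <- traject (turn C) d m) wcorner w (corner_image e).1.
Proof.
rewrite /vertex_walk; elim: (traject _ _ _) => [|e s IH].
  by rewrite /weight !big_nil.
by rewrite /= weight_cat big_cons IH weight_lift.
Qed.

Hypothesis w2 : forall z : seq (oedge (W K)),
  is_cycle z -> homology_reduced z -> 2 <= weight w z.

(** Without a folding pair in L - K, the walk around a vertex never runs through
    a corner outside K in both directions. *)
Lemma vertex_weight_ge2 (v : svert C) :
    (forall d e : dart C, org d = v -> org e = v ->
       corner_image d = obar (corner_image e) ->
       LKface K (lft d) -> LKface K (lft e) -> False) ->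
    v \in LKverts K C ->
  2 <= \sum_(d : dart C | org d == v) wcorner w (corner_image d).1.
Proof.
move=> nofold /LKvertsP[d dv dK]; pose m := fingraph.order (turn C) d.
have orb e : (e \in traject (turn C) d m) = (org e == v).
  by rewrite -dv eq_sym orgP fconnect_orbit.
have -> : \sum_(e : dart C | org e == v) wcorner w (corner_image e).1
    = weight w (vertex_walk d m).
  rewrite weight_vertex_walk big_uniq ?orbit_uniq //=.
  by apply: eq_bigl => e; rewrite -orb.
have tagK (e : dart C) : tag (corner_image e).1 = dcell (lft e).
  by rewrite -dside_cell /corner_image; case: ifP.
have w0 (e : gedge (W K)) : @W_side _ _ K e = None -> w e = 0.
  by case: e => // i _; apply: w_e.
apply: (closed_walk_weight w0 w2 (x := W_point K (dlab d))).
- by have := walk_vertex d m; rewrite iter_order //; apply: perm_inj.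
- have [|p pd pZ] := @lift_LK _ _ K (corner_image d); first by rewrite tagK.
  by exists p => //; apply/In_vertex_walk; exists d; rewrite // orb dv.
move=> a /In_vertex_walk[e]; rewrite orb => /eqP ev ae.
move=> /In_vertex_walk[e']; rewrite orb => /eqP ev' ae'.
apply: contrapT => nZ.
have [u1 s1 k1] := In_lift ae nZ; have [u2 s2 k2] := In_lift ae' nZ.
apply: (nofold e e') => //; rewrite ?/LKface -?tagK //.
move: u1; rewrite u2 => -[e1]; move: s2; rewrite /= s1.
case: (corner_image e) (corner_image e') e1 => [c s] [c' s'] /= -> <-.
by rewrite /obar /= negbK.
Qed.

End VertexWalk.

(** * Relative vertex asphericity *)

Theorem theorem5p5 (R : realType) (L : complex2) (n : nat)
    (K : wedge_subcomplex L n)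
    (hL : cyclically_reduced L)
    (hK : edges_nontrivial K)
    (w : gedge (W K) -> R)
    (h1 : forall r : cellLK K,
      \sum_(i < size (bdry (val r))) w (W_corner i)
        <= (size (bdry (val r)))%:R - 2)
    (h2 : forall z : seq (oedge (W K)),
      is_cycle z -> homology_reduced z -> 2 <= weight w z)
    (h3 : forall i : 'I_n, w (W_e K i) = 0) :
  vertex_aspherical K.
Proof.
move=> C notK; apply: contrapT => nofold.
have [f0 f0K] : exists f : sface C, LKface K f.
  apply: contrapT => nf; apply: notK.
  have inK (f : sface C) : cellK K (dcell f) <> None.
    by move=> e; apply: nf; exists f; apply/eqP.
  split=> // d; have := inK (lft d).
  by case e: (cellK K _) => [i|//] _; rewrite (edgeK_dlab e).
have face_le (f : sface C) : LKface K f ->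
    \sum_(i < size (bdry (dcell f))) wcorner w (mkside i)
      <= (size (bdry (dcell f)))%:R - 2.
  move=> fK; have := h1 (exist _ (dcell f) fK); congr (_ <= _).
  by apply: eq_bigr => i _; rewrite -(wcornerLK w (r := exist _ (dcell f) fK)).
(* A 2-cell without sides would have weight 0 > 0 - 2. *)
have [d0 _] : exists d : dart C, lft d = f0.
  have : #|[set d : dart C | lft d == f0]| <> 0%N.
    rewrite dcell_size => s0; have := face_le _ f0K; rewrite big1 ?s0; first lra.
    by case=> i i0; exfalso; move: i0; rewrite s0.
  by move/eqP; rewrite cards_eq0 => /set0Pn[d]; rewrite inE => /eqP; exists d.
have bound := LKverts_bound hK d0 f0K.
pose cw (d : dart C) := wcorner w (corner_image d).1.
have cwK (d : dart C) : ~~ LKface K (lft d) -> cw d = 0.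
  move=> dK; apply: (wcornerK h3).
  have -> : tag (corner_image d).1 = dcell (lft d); last exact: dK.
  by rewrite -dside_cell /corner_image; case: ifP.
have lower : \sum_(v in LKverts K C) (2 : R) <=
    \sum_(v in LKverts K C) \sum_(d : dart C | org d == v) cw d.
  apply: ler_sum => v vK; apply: vertex_weight_ge2 => // d e dv ev de dK eK.
  by apply: nofold; exists v, d, e; split; [split|apply/eqP..].
(* Each outer corner is counted once, at its vertex and at its 2-cell. *)
have exch : \sum_(v in LKverts K C) \sum_(d : dart C | org d == v) cw d =
    \sum_(f | LKface K f) \sum_(d : dart C | lft d == f) cw d.
  transitivity (\sum_(d : dart C | LKface K (lft d)) cw d).
    rewrite (partition_big (@org C) (mem (LKverts K C))) /=; last first.
      by move=> d dK; apply/LKvertsP; exists d.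
    apply: eq_bigr => v _; rewrite big_mkcond [RHS]big_mkcond /=.
    apply: eq_bigr => d _; case: (boolP (LKface K _)) => //= /cwK ->.
    by case: ifP.
  rewrite (partition_big (@lft C) (LKface K (C := C))) //=.
  apply: eq_bigr => f fK; apply: eq_bigl => d.
  by case: eqP => [->|]; rewrite ?fK ?andbF.
have upper : \sum_(f | LKface K f) \sum_(d : dart C | lft d == f) cw d <=
    \sum_(f : sface C | LKface K f) ((size (bdry (dcell f)))%:R - 2 : R).
  apply: ler_sum => f fK.
  by rewrite (sum_face_corners (wcorner w) f d0) face_le.
move: lower upper; rewrite exch => /le_trans h /h.
have -> : \sum_(v in LKverts K C) (2 : R) = (2 * #|LKverts K C|)%:R.
  by rewrite sumr_const -mulrnA.
rewrite sumrB -natr_sum.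
have -> : \sum_(f : sface C | LKface K f) (2 : R) = (2 * #|@LKface L n K C|)%:R.
  by rewrite sumr_const -mulrnA.
rewrite lerBrDr -natrD ler_nat.
by move: bound; lia.
Qed.
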